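(* Let $\mathcal{D}=(V,E,F)$ be an infinite cellular decomposition of a non-compact surface $S$. In both hyperbolic and Euclidean background geometries, if $\Theta\in(0,\pi)^E$ satisfies condition (C1) (see context), then for any initial value $r(0)\in(0,\infty)^V$ there exists a solution $r(t)$, with initial value $r(0)$, to the combinatorial Ricci flow $$\frac{\mathrm{d}r_i}{\mathrm{d}t}=-K_i\,s(r_i),\qquad\forall v_i\in V,$$ that exists for all time $t\ge0$. Here $s(r_i)=r_i$ in Euclidean background geometry and $s(r_i)=\sinh r_i$ in hyperbolic background geometry.
   Context: $V,E,F$ are the vertices, edges and faces of $\mathcal{D}$; $j\sim i$ means $v_i,v_j$ are joined by an edge $[v_i,v_j]\in E$; the degree $d_i$ (number of edges at $v_i$) is finite; the 1-skeleton $(V,E)$ is assumed connected (graph distance between any two vertices is finite). $\Theta:E\to(0,\pi)$ is the intersection angle function, $\Theta_{ij}=\Theta([v_i,v_j])$. Condition (C1): if edges $e_1,\dots,e_m$ form the boundary of a face, then $\sum_{l=1}^m\Theta(e_l)=(m-2)\pi$. A circle packing metric is a function $r:V\to(0,\infty)$, $r_i=r(v_i)$. For an edge $[v_i,v_j]$, consider the triangle $v_iv_jv_f$ in the Euclidean (resp. hyperbolic) plane with $|v_iv_f|=r_i$, $|v_jv_f|=r_j$ and $|v_iv_j|=l_{ij}$, where $l_{ij}=\sqrt{r_i^2+r_j^2+2r_ir_j\cos\Theta_{ij}}$ (resp. $l_{ij}=\cosh^{-1}(\cosh r_i\cosh r_j+\sinh r_i\sinh r_j\cos\Theta_{ij})$);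 so the angle at $v_f$ in the Euclidean (resp. hyperbolic) triangle is $\pi-\Theta_{ij}$. Let $\theta_{ij}$ be the inner angle at $v_i$. The discrete Gaussian (vertex) curvature is $2\pi$ minus the total cone angle at $v_i$, i.e. $K_i(r)=2\pi-2\sum_{j\sim i}\theta_{ij}(r_i,r_j)$. *)

(* Defs.v *)
From HB Require Import structures.
From mathcomp Require Import all_boot all_order all_algebra.
From mathcomp Require Import all_classical all_reals all_analysis.

Set Implicit Arguments.
Unset Strict Implicit.
Unset Printing Implicit Defensive.

Import Order.TTheory GRing.Theory Num.Theory.
Import numFieldNormedType.Exports.

Local Open Scope classical_set_scope.
Local Open Scope ring_scope.

(* Topological surfaces (without boundary) *)

Definition locally_planar (R : realType) (S : topologicalType) : Prop :=
  forall p : S, exists (U : set S) (phi : S -> R * R) (psi : R * R -> S),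
    [/\ open U /\ U p,
        open (phi @` U),
        (forall x, U x -> psi (phi x) = x),
        {within U, continuous phi} &
        {within phi @` U, continuous psi}].

Definition surface (R : realType) (S : topologicalType) : Prop :=
  [/\ hausdorff_space S, @second_countable S & locally_planar R S].

Definition noncompact (S : topologicalType) : Prop := ~ compact [set: S].

(* Cellular decompositions *)

Definition open_disc (R : realType) : set (R * R) :=
  [set z | z.1 ^+ 2 + z.2 ^+ 2 < 1].

Definition closed_disc (R : realType) : set (R * R) :=
  [set z | z.1 ^+ 2 + z.2 ^+ 2 <= 1].

Definition circle_pt (R : realType) (x : R) : R * R :=
  (cos (2 * pi * x), sin (2 * pi * x)).

(* An oriented edge is a pair (e, b): e traversed backwards when b holds. *)
Definition dpath (R : realType) (S E : Type) (pt : E -> R -> S) (d : E * bool)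
    (t : R) : S :=
  pt d.1 (if d.2 then 1 - t else t).

(* A CW structure on S, of dimension at most 2, given by its characteristic
   maps: vpt for the vertices, ept on [0, 1] for the edges, fpt on the closed
   unit disc for the faces.  Each face is a polygon: the unit circle is cut into
   m arcs of equal length which fpt f maps along the m successive oriented edges
   of the closed walk fbd f.  Loops and multiple edges are allowed, and a face
   may meet the same edge or vertex several times.  The last field is the weak
   topology condition. *)
Record cell_decomposition (R : realType) (S : topologicalType) := {
  vertices : choiceType;
  edges : choiceType;
  faces : choiceType;
  vpt : vertices -> S;
  ept : edges -> R -> S;
  fpt : faces -> R * R -> S;
  esrc : edges -> vertices;
  etgt : edges -> vertices;
  fbd : faces -> seq (edges * bool);
  ept_continuous : forall e, {within `[0, 1], continuous (ept e)};
  ept0 : forall e, ept e 0 = vpt (esrc e);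
  ept1 : forall e, ept e 1 = vpt (etgt e);
  fpt_continuous : forall f, {within @closed_disc R, continuous (fpt f)};
  fbd_neq0 : forall f, (0 < size (fbd f))%N;
  fpt_boundary : forall f (l : 'I_(size (fbd f))) (t : R), 0 <= t <= 1 ->
    fpt f (circle_pt ((l%:R + t) / (size (fbd f))%:R)) =
    dpath ept (tnth (in_tuple (fbd f)) l) t;
  vpt_inj : forall v w, vpt v = vpt w -> v = w;
  ept_inj : forall e e' (t t' : R), 0 < t < 1 -> 0 < t' < 1 ->
    ept e t = ept e' t' -> e = e' /\ t = t';
  fpt_inj : forall f f' z z', open_disc z -> open_disc z' ->
    fpt f z = fpt f' z' -> f = f' /\ z = z';
  vpt_ept : forall v e (t : R), 0 < t < 1 -> vpt v <> ept e t;
  vpt_fpt : forall v f z, open_disc z -> vpt v <> fpt f z;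
  ept_fpt : forall e (t : R) f z, 0 < t < 1 -> open_disc z -> ept e t <> fpt f z;
  cells_cover : forall x : S,
    [\/ exists v, x = vpt v,
        exists e (t : R), 0 < t < 1 /\ x = ept e t |
        exists f z, open_disc z /\ x = fpt f z];
  cells_weak : forall A : set S,
    (forall e, closed (A `&` (ept e @` `[0, 1]))) ->
    (forall f, closed (A `&` (fpt f @` @closed_disc R))) -> closed A
}.

Section Combinatorics.
Variables (R : realType) (S : topologicalType) (D : cell_decomposition R S).

Definition infinite_decomposition : Prop :=
  infinite_set [set: vertices D + edges D + faces D].

Definition oriented_edge : choiceType := (edges D * bool)%type.

Definition dsrc (d : oriented_edge) : vertices D :=
  if d.2 then etgt d.1 else esrc d.1.

Definition dtgt (d : oriented_edge) : vertices D :=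
  if d.2 then esrc d.1 else etgt d.1.

(* The edges at v, each with its orientation away from v; a loop at v occurs
   with both orientations. *)
Definition star (v : vertices D) : set oriented_edge := [set d | dsrc d = v].

Definition finite_degrees : Prop := forall v, finite_set (star v).

Fixpoint walk (v : vertices D) (s : seq oriented_edge) (w : vertices D) : Prop :=
  if s is d :: s' then dsrc d = v /\ walk (dtgt d) s' w else v = w.

Definition connected_skeleton : Prop := forall v w, exists s, walk v s w.

Definition condition_C1 (Theta : edges D -> R) : Prop :=
  forall f, \sum_(d <- fbd f) Theta d.1 = ((size (fbd f))%:R - 2) * pi.

End Combinatorics.

(* Background geometries *)

Definition cosh (R : realType) (x : R) : R := (expR x + expR (- x)) / 2.

Definition sinh (R : realType) (x : R) : R := (expR x - expR (- x)) / 2.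

(* The nonnegative inverse of cosh, meaningful for 1 <= y. *)
Definition arcosh (R : realType) (y : R) : R := ln (y + Num.sqrt (y ^+ 2 - 1)).

Inductive geometry := Euclidean | Hyperbolic.

Section Geometry.
Variables (R : realType) (g : geometry).

Definition edge_length (T ri rj : R) : R :=
  match g with
  | Euclidean => Num.sqrt (ri ^+ 2 + rj ^+ 2 + 2 * ri * rj * cos T)
  | Hyperbolic => arcosh (cosh ri * cosh rj + sinh ri * sinh rj * cos T)
  end.

(* The inner angle between the sides of lengths b and c, opposite to the side of
   length a, given by the law of cosines of the geometry. *)
Definition triangle_angle (a b c : R) : R :=
  match g with
  | Euclidean => acos ((b ^+ 2 + c ^+ 2 - a ^+ 2) / (2 * b * c))
  | Hyperbolic => acos ((cosh b * cosh c - cosh a) / (sinh b * sinh c))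
  end.

(* The inner angle at v_i of the triangle v_i v_j v_f with |v_i v_f| = ri,
   |v_j v_f| = rj and |v_i v_j| = edge_length T ri rj. *)
Definition theta (T ri rj : R) : R :=
  triangle_angle rj ri (edge_length T ri rj).

Definition s_fun (x : R) : R :=
  match g with Euclidean => x | Hyperbolic => sinh x end.

Definition curvature (S : topologicalType) (D : cell_decomposition R S)
    (Theta : edges D -> R) (r : vertices D -> R) (v : vertices D) : R :=
  2 * pi -
  2 * \sum_(d \in star v) theta (Theta d.1) (r (dsrc d)) (r (dtgt d)).

(* Derivative at t of the restriction of f to A: one-sided at an endpoint of an
   interval A. *)
Definition has_derivative_within (A : set R) (f : R -> R) (t l : R) : Prop :=
  (fun u => (f u - f t) / (u - t)) @ within A t^' --> l.

Definition ricci_flow_solution (S : topologicalType)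
    (D : cell_decomposition R S) (Theta : edges D -> R)
    (r : R -> vertices D -> R) : Prop :=
  forall t : R, 0 <= t -> forall v,
    0 < r t v /\
    has_derivative_within [set u | 0 <= u] (fun u => r u v) t
      (- curvature Theta (r t) v * s_fun (r t v)).

End Geometry.

(* Main.v *)
Require Import Defs.
From mathcomp Require Import all_boot all_order all_algebra.
From mathcomp Require Import all_classical all_reals all_analysis.
From mathcomp Require Import ring lra.

Set Implicit Arguments.
Unset Strict Implicit.
Unset Printing Implicit Defensive.

Import Order.TTheory GRing.Theory Num.Theory.
Import numFieldNormedType.Exports.
Local Open Scope classical_set_scope.
Local Open Scope ring_scope.

(** The flow is an ordinary differential equation in a product of infinitely
many lines, whose right-hand side at a vertex depends on finitely many
coordinates only.  The degrees may be unbounded, so there is no uniform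
Lipschitz constant and no contraction argument; existence comes from
compactness instead.  In the coordinates [u = ln r] the equation reads
[u_i' = - K_i * s(r_i) / r_i].

Suppose each coordinate of the right-hand side is bounded by a constant of its
own.  Then the Euler polygons of mesh [1/(n+1)] stay, at each time and each
vertex, in a bounded interval independent of [n], so they converge pointwise
along any ultrafilter finer than [\oo] ([euler_limit_cvg]).  The polygons are
Lipschitz in each coordinate uniformly in [n]; so all their nodes at times close
to [t] are, in finitely many coordinates at once, close to the limit at [t], and
there the continuous right-hand side is close to its value at that limit.
Averaging over the steps gives the derivative of the limit.  This is Peano's
theorem in a product space, for all positive times ([peano]).

The angles lie between [0] and [pi], so [K_i] is bounded in terms of the degree
([curvature_bounded]).  In Euclidean geometry [s(r) / r = 1] and Peano's theorem
applies at once.  In hyperbolic geometry [sinh r / r] is unbounded, but the angle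
at a vertex tends to [0] as the radius there tends to infinity, uniformly in the
other radius ([theta_hyperbolic_small]); hence [K_i > 0] once [r_i] exceeds a
threshold depending only on [i] ([curvature_hyperbolic_gt0]).  The right-hand
side is therefore evaluated at [min u_i b_i] for a level [b_i] above this
threshold and above the initial value.  It becomes bounded, and a solution never
exceeds [b_i], since it would have to increase where its derivative is negative
([derivative_within_barrier]).  So the solution of the capped equation solves
the original one.  Since [r = exp u], positivity is automatic. *)

(** * Euler polygons *)

(** An ultrafilter turns the cluster points given by compactness of a segment
into limits, which spares any extraction of subsequences. *)
Lemma ultra_bounded_cvg (R : realType) (T : Type) (U : set_system T)
    (x : T -> R) (M : R) :
  UltraFilter U -> (forall n, `|x n| <= M) -> exists l : R, x @ U --> l.
Proof.
move=> UU xM.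
have in_segment : (x @ U) [set` `[- M, M]].
  by apply: (@filterS _ U _ setT) filterT => n _; rewrite /= in_itv /= -ler_norml.
have [l [_ l_cluster]] := @segment_compact R (- M) M (x @ U) _ in_segment.
exists l => A lA; have [//|xUA] := in_ultra_setVsetC (x @^-1` A) UU.
by have [y []] := l_cluster (~` A) A xUA lA.
Qed.

Lemma euler_step_estimate (R : realType) (y f : nat -> R) (h l e : R) (a b : nat) :
  0 <= h -> (a <= b)%N -> (forall k, y k.+1 = y k + h * f k) ->
  (forall k, (a <= k < b)%N -> `|f k - l| <= e) ->
  `|y b - y a - (b%:R - a%:R) * h * l| <= (b%:R - a%:R) * h * e.
Proof.
move=> h0 /subnKC <- yS; elim: (b - a)%N => [|m IHm] fl.
  by rewrite addn0 !subrr !mul0r subrr normr0.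
rewrite addnS yS -natr1.
have -> : y (a + m)%N + h * f (a + m)%N - y a - ((a + m)%:R + 1 - a%:R) * h * l
  = (y (a + m)%N - y a - ((a + m)%:R - a%:R) * h * l) + h * (f (a + m)%N - l).
  by ring.
have -> : ((a + m)%:R + 1 - a%:R) * h * e
  = ((a + m)%:R - a%:R) * h * e + h * e by ring.
apply: (le_trans (ler_normD _ _)); apply: lerD.
  by apply: IHm => k /andP[ak kb]; rewrite fl// ak addnS ltnS ltnW.
by rewrite normrM ger0_norm// ler_wpM2l// fl// leq_addr addnS /=.
Qed.

(** Two-sided form of the previous estimate, used to differentiate the limit of
the polygons from the left as well as from the right. *)
Lemma euler_estimate (R : realType) (y f : nat -> R) (h l e : R) (a b : nat) :
  0 <= h -> (forall k, y k.+1 = y k + h * f k) ->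
  (forall k, (minn a b <= k < maxn a b)%N -> `|f k - l| <= e) ->
  `|y b - y a - (b%:R - a%:R) * h * l| <= `|b%:R - a%:R| * h * e.
Proof.
move=> h0 yS; have [ab|/ltnW ba] := leqP a b => fl.
  by rewrite [`|b%:R - _|]ger0_norm ?subr_ge0 ?ler_nat//; apply: euler_step_estimate.
rewrite [`|b%:R - _|]ler0_norm ?subr_le0 ?ler_nat// opprB -[X in X <= _]normrN.
have -> : - (y b - y a - (b%:R - a%:R) * h * l)
   = y a - y b - (a%:R - b%:R) * h * l by ring.
exact: euler_step_estimate.
Qed.

(** * Peano's theorem in a product of lines *)

(** Continuity for the product topology on [V -> R], tested on filtered
families. *)
Definition pointwise_continuous (R : realType) (V : Type) (f : (V -> R) -> R) :=
  forall (T : Type) (G : set_system T) (w : T -> V -> R) (w0 : V -> R),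
    Filter G -> (forall j, (fun x => w x j) @ G --> w0 j) ->
    (fun x => f (w x)) @ G --> f w0.

Section Peano.
Variables (R : realType) (V : Type) (F : (V -> R) -> V -> R) (C u0 : V -> R).
Hypothesis F_bounded : forall w i, `|F w i| <= C i.
Hypothesis F_continuous : forall i, pointwise_continuous (fun w => F w i).

Definition mesh (n : nat) : R := n.+1%:R^-1.

Fixpoint euler (n k : nat) : V -> R :=
  if k is k'.+1 then fun i => euler n k' i + mesh n * F (euler n k') i else u0.

Definition grid (n : nat) (t : R) : nat := Num.truncn (t * n.+1%:R).

Lemma mesh_gt0 n : 0 < mesh n. Proof. by rewrite invr_gt0. Qed.

Lemma grid_close n t : 0 <= t -> `|(grid n t)%:R * mesh n - t| <= mesh n.
Proof.
move=> t0; have /andP[] := truncn_itv (mulr_ge0 t0 (ler0n R n.+1)).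
rewrite -/(grid n t) -ler_pdivrMr// -ltr_pdivlMr//.
rewrite -/(mesh n) -natr1 mulrDl mul1r ler_distl => ? ?; lra.
Qed.

(** The case [l = 0] of [euler_estimate]: this equicontinuity, uniform in [n], is
what makes pointwise limits of the polygons differentiable. *)
Lemma euler_lipschitz n a b i :
  `|euler n b i - euler n a i| <= `|b%:R - a%:R| * mesh n * C i.
Proof.
have := @euler_estimate R (fun k => euler n k i) (fun k => F (euler n k) i)
  (mesh n) 0 (C i) a b (ltW (mesh_gt0 n)) (fun=> erefl).
by rewrite mulr0 subr0; apply => k _; rewrite subr0.
Qed.

Section Limit.
Variables (U : set_system nat) (UU : UltraFilter U) (leU : \oo `<=` U).

Definition euler_limit (t : R) (i : V) : R :=
  get [set l : R | (fun n => euler n (grid n t) i) @ U --> l].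

Lemma euler_limit_cvg t i : 0 <= t ->
  (fun n => euler n (grid n t) i) @ U --> euler_limit t i.
Proof.
move=> t0; rewrite /euler_limit; apply: (@getPex _
  [set l : R | (fun n => euler n (grid n t) i) @ U --> l]).
apply: (@ultra_bounded_cvg _ _ _ _ (`|u0 i| + (t + 1) * C i)) => n.
have C0 : 0 <= C i by exact: le_trans (F_bounded u0 i).
have := euler_lipschitz n 0 (grid n t) i; rewrite subr0 normr_nat => lip.
rewrite -[euler n _ i](subrK (u0 i)) addrC (le_trans (ler_normD _ _))// lerD2l.
apply: (le_trans lip); rewrite ler_wpM2r//.
have := grid_close n t0; rewrite ler_distl => /andP[_ H].
have : mesh n <= 1 by rewrite invf_le1// ler1n.
lra.
Qed.

Lemma mesh_cvg0 : mesh @ U --> (0 : R).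
Proof. exact: cvg_trans (cvg_app _ leU) cvg_harmonic. Qed.

Lemma grid_cvg t : 0 <= t -> (fun n => (grid n t)%:R * mesh n) @ U --> t.
Proof.
move=> t0; apply/cvgrPdist_le => e e0.
have /cvgrPdist_le/(_ _ e0) := mesh_cvg0; apply: filterS => n.
rewrite sub0r normrN ger0_norm ?(ltW (mesh_gt0 _))// distrC; apply: le_trans.
exact: grid_close.
Qed.

(** On the nodes whose times are close to [t], the velocity [F] is almost
constant; hence so is the slope of the polygons between the nodes of [t] and of
a nearby [s], and the slope estimate passes to the limit. *)
Lemma euler_limit_derivative t i : 0 <= t ->
  has_derivative_within [set s | 0 <= s] (euler_limit ^~ i) t
    (F (euler_limit t) i).
Proof.
move=> t0.
(* G is the filter of the nodes (n, k) with n along U and time tending to t. *)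
pose G : set_system (nat * nat) := fun P => exists2 d : R, 0 < d &
  \forall n \near U, forall k, `|k%:R * mesh n - t| <= d -> P (n, k).
have FG : Filter G.
  split; first by exists 1 => //; apply: nearW.
    move=> P Q [d d0 dP] [d' d'0 dQ]; exists (Num.min d d').
      by rewrite lt_min d0 d'0.
    near=> n => k; rewrite le_min => /andP[kd kd']; split.
      by move: k kd {kd'}; near: n.
    by move: k kd' {kd}; near: n.
  move=> P Q PQ [d d0 dP]; exists d => //.
  by apply: filterS dP => n nP k /nP /PQ.
have node_cvg j : (fun p => euler p.1 p.2 j) @ G --> euler_limit t j.
  have C0 : 0 <= C j by exact: le_trans (F_bounded u0 j).
  apply/cvgrPdist_le => e e0.
  have d0 : 0 < e / 4 / (C j + 1) by rewrite !divr_gt0// ltr_wpDl.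
  (* With d this constant, a node at time within d of t is, once the mesh is at
     most d, within 2 d of the node grid n t, so that the j-th coordinates
     differ by at most 2 d C_j <= e / 2. *)
  exists (e / 4 / (C j + 1)) => //.
  have near_t : \forall n \near U,
      `|euler_limit t j - euler n (grid n t) j| <= e / 2.
    have /cvgrPdist_le := @euler_limit_cvg t j t0; apply; lra.
  have near_mesh : \forall n \near U, `|0 - mesh n| <= e / 4 / (C j + 1).
    by have /cvgrPdist_le := mesh_cvg0; apply.
  near=> n => k kt /=.
  rewrite -(subrKA (euler n (grid n t) j)) (le_trans (ler_normD _ _))//.
  rewrite [leRHS]splitr lerD//; first by near: n.
  rewrite (le_trans (euler_lipschitz n k (grid n t) j))//.
  have gt := grid_close n t0.
  have : mesh n <= e / 4 / (C j + 1).
    by rewrite -[mesh n]ger0_norm ?(ltW (mesh_gt0 _))// -normrN -sub0r; near: n.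
  move=> mn.
  have le2 : `|(grid n t)%:R - k%:R| * mesh n <= 2 * (e / 4 / (C j + 1)).
    rewrite -[X in _ * X]ger0_norm ?(ltW (mesh_gt0 _))// -normrM mulrBl.
    rewrite -(subrKA t) (le_trans (ler_normD _ _))// [`|t - _|]distrC.
    lra.
  apply: (le_trans (ler_wpM2r C0 le2)).
  have -> : e / 2 = 2 * (e / 4 / (C j + 1)) * (C j + 1) by field; lra.
  by rewrite ler_wpM2l//; nra.
have F_cvg : (fun p => F (euler p.1 p.2) i) @ G --> F (euler_limit t) i.
  exact: (@F_continuous i _ G (fun p => euler p.1 p.2)).
have /cvgrPdist_le F_node := F_cvg.
apply/cvgrPdist_le => e e0.
have [d d0 near_F] := F_node e e0.
have near_t : \forall s \near t, `|t - s| <= d / 2.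
  apply/nbhs_ballP; exists (d / 2) => /=; first by rewrite divr_gt0.
  by move=> s /ltW.
rewrite near_withinE /dnbhs near_withinE; near=> s => st /= s0.
have d2 : `|t - s| <= d / 2 by near: s; exact: near_t.
have st_gt0 : 0 < `|s - t| by rewrite normr_gt0 subr_eq0.
rewrite -(ler_pM2r st_gt0) -normrM mulrBl mulfVK ?subr_eq0//.
(* The estimate for s and t is the U-limit of the estimate for their nodes. *)
have steps_cvg : (fun n => (grid n s)%:R * mesh n - (grid n t)%:R * mesh n) @ U
    --> s - t by apply: cvgB; exact: grid_cvg.
have lhs_cvg : (fun n => `|F (euler_limit t) i *
      ((grid n s)%:R * mesh n - (grid n t)%:R * mesh n) -
     (euler n (grid n s) i - euler n (grid n t) i)|) @ U -->
   `|F (euler_limit t) i * (s - t) - (euler_limit s i - euler_limit t i)|.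
  apply: cvg_norm; apply: cvgB; first exact: cvgMr.
  by apply: cvgB; exact: euler_limit_cvg.
have rhs_cvg : (fun n =>
    e * `|(grid n s)%:R * mesh n - (grid n t)%:R * mesh n|) @ U --> e * `|s - t|.
  by apply: cvgMr; exact: cvg_norm.
apply: (ler_cvg_to lhs_cvg rhs_cvg).
have near_mesh : \forall n \near U, `|0 - mesh n| <= d / 2.
  by have /cvgrPdist_le := mesh_cvg0; apply; lra.
near=> n.
have meshd : mesh n <= d / 2.
  by rewrite -[mesh n]ger0_norm ?(ltW (mesh_gt0 _))// -normrN -sub0r; near: n.
have mesh0 := mesh_gt0 n.
have gs := grid_close n s0; have gt := grid_close n t0.
have node_close k : (minn (grid n t) (grid n s) <= k < maxn (grid n t) (grid n s))%N ->
   `|F (euler n k) i - F (euler_limit t) i| <= e.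
  move=> kst; rewrite distrC.
  suff kt : `|k%:R * mesh n - t| <= d by move: k kt {kst}; near: n.
  have kmesh a b : (a <= b)%N -> a%:R * mesh n <= b%:R * mesh n.
    by move=> ab; rewrite ler_wpM2r ?ler_nat // (ltW mesh0).
  move: d2 gs gt; rewrite !ler_distl => /andP[? ?] /andP[? ?] /andP[? ?].
  have [ts|/ltnW ts] := leqP (grid n t) (grid n s).
    move: kst; rewrite (minn_idPl ts) (maxn_idPr ts) => /andP[/kmesh ? /ltnW/kmesh ?].
    lra.
  move: kst; rewrite (minn_idPr ts) (maxn_idPl ts) => /andP[/kmesh ? /ltnW/kmesh ?].
  lra.
have := @euler_estimate _ (fun k => euler n k i) _ _ _ _ _ _
  (ltW mesh0) (fun=> erefl) node_close.
move=> est; rewrite distrC -!mulrBl normrM [`|mesh n|]ger0_norm ?(ltW mesh0)//.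
by rewrite [F _ _ * _]mulrC [e * _]mulrC.
Unshelve. all: by end_near. Qed.

End Limit.

Theorem peano : exists u : R -> V -> R, u 0 = u0 /\
  forall t i, 0 <= t ->
    has_derivative_within [set s | 0 <= s] (u ^~ i) t (F (u t) i).
Proof.
have [U [UU leU]] := @ultraFilterLemma nat \oo _.
exists (euler_limit U); split=> [|t i t0]; last exact: euler_limit_derivative.
apply/funext => i; have := @euler_limit_cvg U UU 0 i (lexx 0).
rewrite (_ : (fun n => _) = cst (u0 i)); last first.
  by apply/funext => n; rewrite /grid mul0r truncn0.
by move/(cvg_unique _); apply=> //; exact: cvg_cst.
Qed.

End Peano.

(** * Hyperbolic functions *)

Section Hyperbolic_functions.
Variable R : realType.
Implicit Types x y : R.

Lemma expR_expRN x : expR x * expR (- x) = 1.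
Proof. by rewrite -expRD subrr expR0. Qed.

Lemma cosh_sqr x : cosh x ^+ 2 = 1 + sinh x ^+ 2.
Proof. have := expR_expRN x; rewrite /cosh /sinh; nra. Qed.

Lemma sinh_gt0 x : 0 < x -> 0 < sinh x.
Proof. by move=> x0; rewrite divr_gt0// subr_gt0 ltr_expR; lra. Qed.

Lemma cosh_gt0 x : 0 < cosh x.
Proof. by rewrite divr_gt0// addr_gt0// expR_gt0. Qed.

Lemma sinh_lt_cosh x : sinh x < cosh x.
Proof. have := expR_gt0 (- x); rewrite /cosh /sinh; lra. Qed.

Lemma cosh_subr1_lt_sinh x : 0 < x -> cosh x - 1 < sinh x.
Proof.
move=> x0; suff : expR (- x) < 1 by rewrite /cosh /sinh; lra.
by rewrite -expR0 ltr_expR; lra.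
Qed.

Lemma lt_cosh x : x / 2 < cosh x.
Proof. have := expR_ge1Dx x; have := expR_gt0 (- x); rewrite /cosh; lra. Qed.

Lemma expR_arcosh y : 1 <= y -> expR (arcosh y) = y + Num.sqrt (y ^+ 2 - 1).
Proof.
by move=> y1; rewrite lnK// posrE ltr_wpDr ?sqrtr_ge0//; lra.
Qed.

(** [y - sqrt (y^2 - 1)] is the inverse of [y + sqrt (y^2 - 1)]. *)
Lemma expRN_arcosh y : 1 <= y -> expR (- arcosh y) = y - Num.sqrt (y ^+ 2 - 1).
Proof.
move=> y1; have := expR_expRN (arcosh y); have := expR_gt0 (arcosh y).
rewrite expR_arcosh//.
have : Num.sqrt (y ^+ 2 - 1) ^+ 2 = y ^+ 2 - 1 by rewrite sqr_sqrtr//; nra.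
set w := Num.sqrt _; set z := expR _ => w2 yw0 yw.
by apply: (mulfI (lt0r_neq0 yw0)); rewrite yw; lra.
Qed.

Lemma cosh_arcosh y : 1 <= y -> cosh (arcosh y) = y.
Proof. by move=> y1; rewrite /cosh expR_arcosh// expRN_arcosh//; lra. Qed.

Lemma sinh_arcosh y : 1 <= y -> sinh (arcosh y) = Num.sqrt (y ^+ 2 - 1).
Proof. by move=> y1; rewrite /sinh expR_arcosh// expRN_arcosh//; lra. Qed.

(** Multiplied by [expR (- x)], this is [1 - expR (- 2 x) <= 2 x]. *)
Lemma sinh_le_mul_expR x : 0 < x -> sinh x <= x * expR x.
Proof.
move=> x0; have := expR_ge1Dx (- (2 * x)); have := expR_gt0 x.
have -> : expR (- (2 * x)) = expR (- x) * expR (- x) by rewrite -expRD; congr expR; lra.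
have := expR_expRN x; rewrite /sinh; set e := expR x; set f := expR (- x) => ef e0 h.
have : e * (1 + - (2 * x)) <= e * (f * f) by rewrite ler_wpM2l// ltW.
by rewrite mulrA ef; lra.
Qed.

Lemma cvg_expR (T : Type) (G : set_system T) (f : T -> R) (l : R) : Filter G ->
  f @ G --> l -> (fun t => expR (f t)) @ G --> expR l.
Proof. by move=> FG; apply: continuous_cvg; exact: continuous_expR. Qed.

Lemma cvg_cosh (T : Type) (G : set_system T) (f : T -> R) (l : R) : Filter G ->
  f @ G --> l -> (fun t => cosh (f t)) @ G --> cosh l.
Proof.
by move=> FG fl; apply: cvgMl; apply: cvgD; apply: cvg_expR => //; exact: cvgN.
Qed.

Lemma cvg_sinh (T : Type) (G : set_system T) (f : T -> R) (l : R) : Filter G ->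
  f @ G --> l -> (fun t => sinh (f t)) @ G --> sinh l.
Proof.
by move=> FG fl; apply: cvgMl; apply: cvgB; apply: cvg_expR => //; exact: cvgN.
Qed.

End Hyperbolic_functions.

(** * Angles of the triangles *)

Lemma quotient_itv (R : realType) (x y : R) :
  0 < y -> x ^+ 2 < y ^+ 2 -> -1 < x / y < 1.
Proof.
move=> y0 xy; rewrite ltr_pdivlMr// ltr_pdivrMr//.
by apply/andP; split; rewrite ltNge; apply/negP; nra.
Qed.

Section Angles.
Variable R : realType.
Implicit Types (g : geometry) (T a b : R).

(** The quotient given by the law of cosines.  It is the cosine of [theta] because
it lies between [-1] and [1] ([cos_theta_itv]). *)
Definition cos_theta g T a b : R :=
  let l := edge_length g T a b in
  match g with
  | Euclidean => (a ^+ 2 + l ^+ 2 - b ^+ 2) / (2 * a * l)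
  | Hyperbolic => (cosh a * cosh l - cosh b) / (sinh a * sinh l)
  end.

Lemma thetaE g T a b : theta g T a b = acos (cos_theta g T a b).
Proof. by case: g. Qed.

Lemma cos_sqr_lt1 T : 0 < T < pi -> cos T ^+ 2 < 1.
Proof. by move=> /sin_gt0_pi; have := cos2Dsin2 T; nra. Qed.

Lemma cos_lt_abs1 T : 0 < T < pi -> -1 < cos T < 1.
Proof. by move/cos_sqr_lt1 => c1; apply/andP; nra. Qed.

Section Euclidean_edge.
Variables (T a b : R).
Hypotheses (T_itv : 0 < T < pi) (a0 : 0 < a) (b0 : 0 < b).

Lemma euclidean_radicand_gt0 : 0 < a ^+ 2 + b ^+ 2 + 2 * a * b * cos T.
Proof.
have /andP[c1 _] := cos_lt_abs1 T_itv.
have : 0 < a * b * (1 + cos T) by rewrite !mulr_gt0//; lra.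
have := sqr_ge0 (a - b); nra.
Qed.

Lemma euclidean_length_gt0 : 0 < edge_length Euclidean T a b.
Proof. by rewrite sqrtr_gt0 euclidean_radicand_gt0. Qed.

(** The side of length [l] projects onto the side of length [a] with length
[a + b * cos T], since the angle between the sides [a] and [b] is [pi - T]. *)
Lemma cos_theta_euclidean :
  cos_theta Euclidean T a b = (a + b * cos T) / edge_length Euclidean T a b.
Proof.
have l0 := euclidean_length_gt0; rewrite /cos_theta.
have l2 : edge_length Euclidean T a b ^+ 2 = a ^+ 2 + b ^+ 2 + 2 * a * b * cos T.
  by rewrite sqr_sqrtr// ltW// euclidean_radicand_gt0.
rewrite l2; move: (edge_length _ _ _ _) l0 => l l0.
by field; rewrite !gt_eqF.
Qed.

End Euclidean_edge.

Section Hyperbolic_edge.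
Variables (T a b : R).
Hypotheses (T_itv : 0 < T < pi) (a0 : 0 < a) (b0 : 0 < b).

(* The hyperbolic cosine of the edge length. *)
Let y := cosh a * cosh b + sinh a * sinh b * cos T.

(** [y > cosh a * cosh b - sinh a * sinh b = cosh (a - b) >= 1]; the last
inequality amounts to [(sinh a - sinh b)^2 >= 0]. *)
Lemma hyperbolic_radicand_gt1 : 1 < y.
Proof.
have /andP[c1 _] := cos_lt_abs1 T_itv; rewrite /y.
have := cosh_sqr a; have := cosh_sqr b; have := sinh_gt0 a0; have := sinh_gt0 b0.
have := cosh_gt0 a; have := cosh_gt0 b.
move: (cosh a) (cosh b) (sinh a) (sinh b) (cos T) c1 => A B p q c c1 B0 A0 q0 p0 B2 A2.
have pq0 : 0 < p * q by rewrite mulr_gt0.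
have AB0 : 0 < A * B by rewrite mulr_gt0.
have AB : (1 + p * q) ^+ 2 <= (A * B) ^+ 2.
  by rewrite exprMn A2 B2; have := sqr_ge0 (p - q); nra.
have : 1 + p * q <= A * B by rewrite -(ler_pXn2r (n := 2))// nnegrE; lra.
nra.
Qed.

Lemma cos_theta_hyperbolic :
  cos_theta Hyperbolic T a b =
  (sinh a * cosh b + cosh a * sinh b * cos T) / Num.sqrt (y ^+ 2 - 1).
Proof.
have y1 := hyperbolic_radicand_gt1.
rewrite /cos_theta /edge_length -/y cosh_arcosh ?ltW// sinh_arcosh ?ltW//.
have w0 : 0 < Num.sqrt (y ^+ 2 - 1) by rewrite sqrtr_gt0; nra.
have p0 := sinh_gt0 a0.
have -> : cosh a * y - cosh b =
  sinh a * (sinh a * cosh b + cosh a * sinh b * cos T).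
  have -> : cosh a * y - cosh b = cosh a ^+ 2 * cosh b - cosh b
     + cosh a * sinh a * sinh b * cos T by rewrite /y; ring.
  by rewrite cosh_sqr; ring.
by field; rewrite !gt_eqF.
Qed.

(** [sinh^2 l = (sinh l * cos theta)^2 + (sinh l * sin theta)^2], where the law of
sines gives [sinh l * sin theta = sinh b * sin T]. *)
Lemma hyperbolic_radicand_decomposition :
  y ^+ 2 - 1 = (sinh a * cosh b + cosh a * sinh b * cos T) ^+ 2
               + sinh b ^+ 2 * (1 - cos T ^+ 2).
Proof.
rewrite /y; have := cosh_sqr a; have := cosh_sqr b.
move: (cosh a) (cosh b) (sinh a) (sinh b) (cos T) => A B p q c B2 A2.
have -> : (A * B + p * q * c) ^+ 2 = A ^+ 2 * B ^+ 2 + 2 * A * B * p * q * c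
  + p ^+ 2 * q ^+ 2 * c ^+ 2 by ring.
have -> : (p * B + A * q * c) ^+ 2 = p ^+ 2 * B ^+ 2 + 2 * A * B * p * q * c
  + A ^+ 2 * q ^+ 2 * c ^+ 2 by ring.
by rewrite A2 B2; ring.
Qed.

End Hyperbolic_edge.

(** The triangle is never degenerate because [T] is neither [0] nor [pi].  The
strict bounds matter: [acos] is continuous only inside the interval. *)
Lemma cos_theta_itv g T a b : 0 < T < pi -> 0 < a -> 0 < b ->
  -1 < cos_theta g T a b < 1.
Proof.
move=> T_itv a0 b0; have c1 := cos_sqr_lt1 T_itv; case: g.
  rewrite cos_theta_euclidean//; apply: quotient_itv.
    exact: euclidean_length_gt0.
  rewrite sqr_sqrtr ?ltW ?euclidean_radicand_gt0//.
  have : 0 < b ^+ 2 * (1 - cos T ^+ 2) by rewrite mulr_gt0 ?exprn_gt0 ?subr_gt0.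
  nra.
have y1 := hyperbolic_radicand_gt1 T_itv a0 b0.
rewrite cos_theta_hyperbolic//; apply: quotient_itv.
  by rewrite sqrtr_gt0; nra.
rewrite sqr_sqrtr; last by nra.
rewrite hyperbolic_radicand_decomposition ltrDl.
by rewrite mulr_gt0 ?subr_gt0// exprn_gt0// sinh_gt0.
Qed.

Lemma theta_itv g T a b : 0 < T < pi -> 0 < a -> 0 < b -> 0 <= theta g T a b <= pi.
Proof.
move=> T_itv a0 b0; have /andP[] := cos_theta_itv g T_itv a0 b0.
by move=> lo hi; rewrite thetaE acos_ge0 ?acos_lepi// !ltW.
Qed.

Lemma edge_length_gt0 g T a b :
  0 < T < pi -> 0 < a -> 0 < b -> 0 < edge_length g T a b.
Proof.
case: g => T_itv a0 b0; first exact: euclidean_length_gt0.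
have y1 := hyperbolic_radicand_gt1 T_itv a0 b0.
by rewrite ln_gt0// (lt_le_trans y1)// lerDl sqrtr_ge0.
Qed.

Section Continuity.
Variables (I : Type) (G : set_system I) (FG : Filter G).
Variables (T a b : R) (f h : I -> R).
Hypotheses (T_itv : 0 < T < pi) (a0 : 0 < a) (b0 : 0 < b).
Hypotheses (fa : f @ G --> a) (hb : h @ G --> b).

Lemma cvg_edge_length g :
  (fun i => edge_length g T (f i) (h i)) @ G --> edge_length g T a b.
Proof.
case: g.
  apply: continuous_cvg; first exact: sqrt_continuous.
  apply: cvgD; first by apply: cvgD; exact: cvgM.
  by apply: cvgMl; apply: cvgM => //; exact: cvgMr.
have y1 := hyperbolic_radicand_gt1 T_itv a0 b0.
have y_cvg : (fun i => cosh (f i) * cosh (h i) + sinh (f i) * sinh (h i) * cos T) @ G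
    --> cosh a * cosh b + sinh a * sinh b * cos T.
  apply: cvgD; first by apply: cvgM; exact: cvg_cosh.
  by apply: cvgMl; apply: cvgM; exact: cvg_sinh.
rewrite /edge_length /arcosh.
apply: (@continuous_cvg _ _ _ _ _ _ (@ln R)).
  by apply: continuous_ln; rewrite ltr_wpDr ?sqrtr_ge0//; lra.
apply: cvgD => //; apply: continuous_cvg; first exact: sqrt_continuous.
by apply: cvgB; [exact: cvgM|exact: cvg_cst].
Qed.

Lemma cvg_theta g : (fun i => theta g T (f i) (h i)) @ G --> theta g T a b.
Proof.
have l0 := edge_length_gt0 g T_itv a0 b0; have l_cvg := @cvg_edge_length g.
suff : (fun i => cos_theta g T (f i) (h i)) @ G --> cos_theta g T a b.
  have /(cos_theta_itv g)/(_ a0 b0) cos_itv := T_itv.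
  move=> cos_cvg.
  rewrite thetaE (_ : (fun i => _) = (fun i => acos (cos_theta g T (f i) (h i)))).
    by apply: (@continuous_cvg _ _ _ _ _ _ (@acos R)) => //; exact: continuous_acos.
  by apply/funext => i; rewrite thetaE.
rewrite /cos_theta /=; case: g l0 l_cvg => /= l0 l_cvg; apply: cvgM.
- by apply: cvgB; [apply: cvgD|]; exact: cvgM.
- apply: cvgV; first by rewrite gt_eqF// !mulr_gt0.
  by apply: cvgM => //; exact: cvgMr.
- by apply: cvgB; [apply: cvgM|]; exact: cvg_cosh.
- apply: cvgV; first by rewrite gt_eqF// mulr_gt0// sinh_gt0.
  by apply: cvgM; exact: cvg_sinh.
Qed.

End Continuity.

Lemma acos_le (e x : R) : 0 < e <= pi -> -1 <= x <= 1 -> cos e <= x -> acos x <= e.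
Proof.
move=> /andP[e0 epi] x1 ex; rewrite leNgt; apply/negP => ex'.
move: ex; rewrite leNgt => /negP; apply.
by rewrite -[x]acosK ?in_itv//= ltr_cos// in_itv /= ?acos_ge0 ?acos_lepi// (ltW e0).
Qed.

(** By the laws of sines and cosines,
[tan theta = sinh b * sin T / (sinh a * cosh b + cosh a * sinh b * cos T)], which,
for large [a], is at most [1 / (sinh a + cosh a * cos T)] because [sinh b < cosh b].  This bound
does not involve [b], and its denominator tends to infinity with [a] as
[cos T > -1]. *)
Lemma theta_hyperbolic_small T (e : R) : 0 < T < pi -> 0 < e <= pi ->
  \forall a \near +oo, forall b, 0 < b -> theta Hyperbolic T a b <= e.
Proof.
move=> T_itv e_itv; have /andP[c1 _] := cos_lt_abs1 T_itv.
have c2 := cos_sqr_lt1 T_itv.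
have k1 : cos e < 1.
  have /andP[e0 epi] := e_itv.
  by rewrite -cos0 ltr_cos// in_itv /= ?lexx ?pi_ge0// epi ltW.
(* N / w below is cos theta.  If N >= L * sinh b, then
   sin^2 theta / cos^2 theta <= L^-2 <= 1 - cos e, by the choice of L. *)
pose L := 1 + (1 - cos e)^-1.
near=> a => b b0.
have a0 : 0 < a by near: a; by apply: nbhs_pinfty_gt; rewrite ?num_real.
have aL : 2 * ((L + 1) / (1 + cos T)) < a by near: a; by apply: nbhs_pinfty_gt; rewrite ?num_real.
have y1 := hyperbolic_radicand_gt1 T_itv a0 b0.
rewrite thetaE; apply: acos_le => //.
  by have /andP[? ?] := cos_theta_itv Hyperbolic T_itv a0 b0; rewrite !ltW.
rewrite cos_theta_hyperbolic//.
have dec := hyperbolic_radicand_decomposition T a b.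
set w2 := _ ^+ 2 - 1 in dec *; have w20 : 0 < w2 by rewrite /w2; nra.
have w0 : 0 < Num.sqrt w2 by rewrite sqrtr_gt0.
rewrite ler_pdivlMr//.
have ws : Num.sqrt w2 ^+ 2 = w2 by rewrite sqr_sqrtr// ltW.
have pc : L <= sinh a + cosh a * cos T.
  have := cosh_subr1_lt_sinh a0; have := lt_cosh a => ca sa.
  have : L + 1 < cosh a * (1 + cos T) by rewrite -ltr_pdivrMr; lra.
  lra.
have q0 := sinh_gt0 b0; have := sinh_lt_cosh b => qB.
have p0 := sinh_gt0 a0.
have N_ge : L * sinh b <= sinh a * cosh b + cosh a * sinh b * cos T by nra.
have k0 : 0 < 1 - cos e by lra.
have Lk : 1 <= (1 - cos e) * L.
  by rewrite /L mulrDr mulr1 mulfV ?gt_eqF//; lra.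
have L1 : 1 <= L by rewrite /L lerDl invr_ge0 ltW.
move: dec ws N_ge; set N := sinh a * _ + _; set w := Num.sqrt w2 => dec ws N_ge.
have N0 : 0 < N by nra.
have q2 : sinh b ^+ 2 <= (1 - cos e) * N ^+ 2.
  have : (L * sinh b) ^+ 2 <= N ^+ 2 by rewrite ler_pXn2r// nnegrE; nra.
  have : sinh b ^+ 2 <= (1 - cos e) * (L * sinh b) ^+ 2.
    rewrite -subr_ge0.
    have -> : (1 - cos e) * (L * sinh b) ^+ 2 - sinh b ^+ 2
      = ((1 - cos e) * L ^+ 2 - 1) * sinh b ^+ 2 by ring.
    by rewrite mulr_ge0 ?sqr_ge0// subr_ge0; nra.
  nra.
have Nw : N <= w.
  have : 0 <= sinh b ^+ 2 * (1 - cos T ^+ 2) by rewrite mulr_ge0 ?sqr_ge0//; lra.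
  by move=> H; rewrite -(ler_pXn2r (n := 2)) ?nnegrE ?(ltW N0) ?(ltW w0)// ws dec lerDl.
(* Since N <= w, it suffices to bound N^2 / w^2, which is at most N / w. *)
suff : cos e * w ^+ 2 <= N * w by rewrite expr2 mulrA ler_pM2r.
suff : cos e * w ^+ 2 <= N ^+ 2.
  by move/le_trans; apply; rewrite expr2 ler_pM2l.
rewrite ws dec.
have := sqr_ge0 (cos T); have := sqr_ge0 (sinh b) => q20 cT20.
have : cos e * (sinh b ^+ 2 * (1 - cos T ^+ 2)) <= sinh b ^+ 2.
  have : (1 - cos T ^+ 2) * cos e <= 1 by nra.
  nra.
lra.
Unshelve. all: by end_near. Qed.

End Angles.

(** * One-sided derivatives *)

Section One_sided_derivatives.
Variable R : realType.
Implicit Types (A : set R) (f : R -> R) (t l : R).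

(** Unlike the difference quotient, this form makes sense at [s = t]. *)
Lemma derivative_within_approx A f t l : has_derivative_within A f t l ->
  forall e, 0 < e -> \forall s \near t, A s ->
    `|f s - f t - l * (s - t)| <= e * `|s - t|.
Proof.
move=> /cvgrPdist_le fl e e0; have := fl e e0.
rewrite near_withinE /dnbhs near_withinE; apply: filterS => s fs As.
have [->|st] := eqVneq s t; first by rewrite !subrr mulr0 subr0 normr0 mulr0.
have st0 : 0 < `|s - t| by rewrite normr_gt0 subr_eq0.
have := fs st As; rewrite -(ler_pM2r st0) -normrM mulrBl mulfVK ?subr_eq0//.
by rewrite distrC.
Qed.

Lemma derivative_within_cvg A f t l : has_derivative_within A f t l ->
  f @ within A (nbhs t) --> f t.
Proof.
move=> /derivative_within_approx/(_ 1 ltr01) approx; apply/cvgrPdist_le => e e0.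
have l0 : 0 < 1 + `|l| by rewrite ltr_pwDl.
have close : \forall s \near t, `|s - t| <= e / (1 + `|l|).
  apply/nbhs_ballP; exists (e / (1 + `|l|)) => /=; first by rewrite divr_gt0.
  by move=> s /ltW; rewrite /= distrC.
rewrite near_withinE; near=> s => As.
have : `|s - t| * (1 + `|l|) <= e by rewrite -ler_pdivlMr//; near: s.
have : `|f s - f t - l * (s - t)| <= 1 * `|s - t| by move: As; near: s.
move=> approx_s close_s; rewrite distrC -(subrK (l * (s - t)) (f s - f t)).
by rewrite (le_trans (ler_normD _ _))// normrM; nra.
Unshelve. all: by end_near. Qed.

(** Convexity squeezes the increment [expR (f s) - expR (f t)] between its tangent
values at [f t] and at [f s], so that dividing by [f s - f t], which may vanish,
is avoided. *)
Lemma derivative_within_expR A f t l : has_derivative_within A f t l ->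
  has_derivative_within A (fun s => expR (f s)) t (expR (f t) * l).
Proof.
move=> fl.
have f_cvg : f @ within A t^' --> f t.
  apply: cvg_trans (derivative_within_cvg fl).
  apply: cvg_app => B; rewrite /dnbhs /within /=.
  by move=> tB; apply: (@filterS _ (nbhs t)) tB => s sB _.
have exp_cvg : (fun s => expR (f s)) @ within A t^' --> expR (f t).
  exact: cvg_expR.
pose q s := (f s - f t) / (s - t).
have bound_cvg : (fun s => `|expR (f s) - expR (f t)| * `|q s|) @ within A t^'
    --> `|expR (f t) - expR (f t)| * `|l|.
  apply: cvgM; apply: cvg_norm => //.
  by apply: cvgB => //; exact: cvg_cst.
rewrite subrr normr0 mul0r in bound_cvg.
have main_cvg : (fun s => expR (f t) * q s) @ within A t^' --> expR (f t) * l.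
  exact: cvgMr.
rewrite /has_derivative_within -[_ * l]addr0.
rewrite (_ : (fun u => _) = (fun s => expR (f t) * q s +
  ((expR (f s) - expR (f t)) / (s - t) - expR (f t) * q s))); last first.
  by apply/funext => s; ring.
apply: cvgD => //; apply/norm_cvg0P; apply: squeeze_cvgr bound_cvg; last exact: cvg_cst.
apply: nearW => s; rewrite normr_ge0 /= /q.
have lo := expR_ge1Dx (f s - f t); have hi := expR_ge1Dx (f t - f s).
have lo' : expR (f t) * (f s - f t) <= expR (f s) - expR (f t).
  have : expR (f t) * (1 + (f s - f t)) <= expR (f t) * expR (f s - f t).
    by rewrite ler_pM2l// expR_gt0.
  by rewrite -expRD [f t + _]addrC subrK; lra.
have hi' : expR (f s) - expR (f t) <= expR (f s) * (f s - f t).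
  have : expR (f s) * (1 + (f t - f s)) <= expR (f s) * expR (f t - f s).
    by rewrite ler_pM2l// expR_gt0.
  by rewrite -expRD [f s + _]addrC subrK; lra.
rewrite mulrA -mulrBl !normrM mulrA ler_wpM2r//.
rewrite -normrM [leRHS]ger0_norm; last by nra.
by rewrite ger0_norm; nra.
Qed.

(** A maximum of [f] on [0, t1] above the level [B] would be attained at some
[c > 0]; there the derivative is negative, so [f] is larger just before [c]. *)
Lemma derivative_within_barrier f (f' : R -> R) (B : R) :
  (forall t, 0 <= t -> has_derivative_within [set s | 0 <= s] f t (f' t)) ->
  f 0 <= B -> (forall t, 0 <= t -> B <= f t -> f' t < 0) ->
  forall t, 0 <= t -> f t <= B.
Proof.
move=> fD f0 f'_lt0 t1 t10.
have f_cont : {within `[0, t1], continuous f}.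
  apply/subspace_continuousP => t /=; rewrite in_itv /= => /andP[t0 _].
  apply: cvg_trans (derivative_within_cvg (fD t t0)).
  apply: cvg_app; apply: within_subset => s /=.
  by rewrite in_itv /= => /andP[].
have [c] := EVT_max t10 f_cont; rewrite in_itv /= => /andP[c0 ct1] c_max.
apply: (@le_trans _ _ (f c)); first by apply: c_max; rewrite in_itv /= t10 lexx.
rewrite leNgt; apply/negP => Bc.
have cpos : 0 < c.
  rewrite lt_neqAle c0 andbT; apply/eqP => c_eq0.
  by move: Bc; rewrite -c_eq0 ltNge f0.
have l0 := f'_lt0 c c0 (ltW Bc).
have e0 : 0 < - f' c / 2 by lra.
have /nbhs_ballP[d /= d0 near_c] := derivative_within_approx (fD c c0) e0.
pose s := Num.max 0 (c - d / 2).
have s0 : 0 <= s by rewrite le_max lexx.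
have sc : s < c by rewrite gt_max cpos /=; lra.
have sd : c - d / 2 <= s by rewrite le_max lexx orbT.
have := near_c s; rewrite /ball /= ger0_norm; last by lra.
move=> /(_ ltac:(lra) s0); rewrite [`|s - c|]ler0_norm; last by lra.
rewrite ler_distl => /andP[lo _].
have : f s <= f c by apply: c_max; rewrite in_itv /= s0 /=; lra.
nra.
Qed.

End One_sided_derivatives.

(** * Curvature *)

Lemma cvg_sum (R : realType) (I J : Type) (G : set_system I) (s : seq J)
    (f : J -> I -> R) (l : J -> R) : Filter G -> (forall j, f j @ G --> l j) ->
  (fun i => \sum_(j <- s) f j i) @ G --> \sum_(j <- s) l j.
Proof.
move=> FG fl; apply: (@cvg_big _ _ _ _ _ _ _ _ _ f) => //.
exact: (@add_continuous R^o).
Qed.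

Section Curvature.
Variables (R : realType) (S : topologicalType) (D : cell_decomposition R S).
Hypothesis hdeg : finite_degrees D.
Variable Theta : edges D -> R.
Hypothesis hTheta : forall e, 0 < Theta e < pi.
Implicit Types (g : geometry) (r : vertices D -> R) (v : vertices D).

Definition star_seq v : seq (oriented_edge D) :=
  finmap.enum_fset (fset_set (star v)).

Lemma curvatureE g r v : curvature g Theta r v =
  2 * pi - 2 * \sum_(d <- star_seq v) theta g (Theta d.1) (r (dsrc d)) (r (dtgt d)).
Proof. by rewrite /curvature fsbig_finite. Qed.

Lemma curvature_bounded g r v : (forall w, 0 < r w) ->
  `|curvature g Theta r v| <= 2 * pi * (1 + (size (star_seq v))%:R).
Proof.
move=> r0; have pi0 := pi_gt0 R; rewrite curvatureE.
elim: (star_seq v) => [|d ds IH].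
  by rewrite big_nil mulr0 subr0 addr0 mulr1 ger0_norm// mulr_ge0// ltW.
rewrite big_cons /= -natr1.
have := theta_itv g (hTheta d.1) (r0 (dsrc d)) (r0 (dtgt d)).
move: IH; rewrite !ler_norml => /andP[? ?] /andP[? ?].
by apply/andP; split; nra.
Qed.

Lemma curvature_continuous g v r0 (I : Type) (G : set_system I)
    (r : I -> vertices D -> R) : Filter G -> (forall w, 0 < r0 w) ->
  (forall w, (fun i => r i w) @ G --> r0 w) ->
  (fun i => curvature g Theta (r i) v) @ G --> curvature g Theta r0 v.
Proof.
move=> FG r0_gt0 r_cvg; rewrite curvatureE.
rewrite (_ : (fun i => _) = (fun i => 2 * pi - 2 *
  \sum_(d <- star_seq v) theta g (Theta d.1) (r i (dsrc d)) (r i (dtgt d)))).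
  apply: cvgB; first exact: cvg_cst.
  apply: cvgMr; apply: cvg_sum => d; exact: cvg_theta.
by apply/funext => i; rewrite curvatureE.
Qed.

(** When the radius at [v] is large, each of the [n] angles at [v] is at most
[pi / (n + 1)], so that the cone angle is less than [2 * pi]. *)
Lemma curvature_hyperbolic_gt0 v :
  \forall x \near +oo, forall r, (forall w, 0 < r w) -> x <= r v ->
    0 < curvature Hyperbolic Theta r v.
Proof.
have pi0 := pi_gt0 R.
pose n := size (star_seq v); pose e : R := pi / n.+1%:R.
have e_itv : 0 < e <= pi.
  by rewrite divr_gt0//= ler_pdivrMr// ler_peMr ?ler1n// ltW.
have sum_le : \forall x \near +oo, forall r, (forall w, 0 < r w) -> x <= r v ->
    \sum_(d <- star_seq v) theta Hyperbolic (Theta d.1) (r (dsrc d)) (r (dtgt d))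
    <= n%:R * e.
  have: {in star_seq v, forall d, dsrc d = v}.
    by move=> d; rewrite in_fset_set// inE.
  rewrite /n; elim: (star_seq v) => [|d ds IH] src.
    by apply: nearW => x r _ _; rewrite big_nil mul0r.
  have {}IH := IH (fun d' h => src d' (mem_behead (s := d :: ds) h)).
  have [M [_ d_small]] := theta_hyperbolic_small (hTheta d.1) e_itv.
  near=> x => r r0 xr; rewrite big_cons [size _]/= -natr1 mulrDl mul1r addrC lerD//.
    by move: r r0 xr; near: x.
  apply: d_small => //; rewrite src ?mem_head// (lt_le_trans _ xr)//.
  by near: x; apply: nbhs_pinfty_gt; rewrite num_real.
apply: filterS sum_le => x sum_le r r0 xr; rewrite curvatureE.
have := sum_le r r0 xr; suff : n%:R * e < pi by lra.
by rewrite mulrA ltr_pdivrMr// mulrC ltr_pM2l// ltr_nat.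
Unshelve. all: by end_near. Qed.

(** * The capped flow *)

Definition cap g (b x : R) : R :=
  match g with Euclidean => x | Hyperbolic => Num.min x b end.

Lemma cap_continuous g b : continuous (cap g b).
Proof.
case: g => x; first exact: cvg_id.
by apply: (@continuous_min _ R^o id (cst b)); [exact: cvg_id|exact: cvg_cst].
Qed.

(** The velocity of [u = ln r] under the flow, evaluated at the capped radii. *)
Definition log_speed g (b : vertices D -> R) (u : vertices D -> R) v : R :=
  let r w := expR (cap g (b w) (u w)) in
  - curvature g Theta r v * (s_fun g (r v) / r v).

Lemma s_fun_ratio_bounded g b :
  exists M, forall x, let y := expR (cap g b x) in `|s_fun g y / y| <= M.
Proof.
(* In hyperbolic geometry sinh y / y <= expR y, where y <= expR b. *)
exists (expR (expR b) + 1) => x.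
set y := expR _; have y0 : 0 < y by exact: expR_gt0.
case: g @y y0 => /= y0.
  by rewrite divff ?gt_eqF// normr1 lerDr expR_ge0.
have s0 := sinh_gt0 y0.
rewrite ger0_norm; last by rewrite divr_ge0 ?ltW.
rewrite ler_pdivrMr// mulrC (le_trans (sinh_le_mul_expR y0))// ler_pM2l//.
apply: (@le_trans _ _ (expR (expR b))); last by rewrite lerDl.
by rewrite !ler_expR ge_min lexx orbT.
Qed.

Lemma log_speed_bounded g b v : exists M, forall u, `|log_speed g b u v| <= M.
Proof.
have [M s_le] := s_fun_ratio_bounded g (b v).
exists (2 * pi * (1 + (size (star_seq v))%:R) * M) => u.
rewrite normrM normrN ler_pM ?s_le// curvature_bounded// => w; exact: expR_gt0.
Qed.

Lemma log_speed_continuous g b v :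
  pointwise_continuous (fun u => log_speed g b u v).
Proof.
move=> T G w w0 FG w_cvg.
have r_cvg j : (fun x => expR (cap g (b j) (w x j))) @ G --> expR (cap g (b j) (w0 j)).
  by apply: cvg_expR; apply: continuous_cvg => //; exact: cap_continuous.
apply: cvgM.
  by apply: cvgN; apply: curvature_continuous => // j; exact: expR_gt0.
apply: cvgM; last by apply: cvgV => //; rewrite gt_eqF// expR_gt0.
by case: g r_cvg => r_cvg; [exact: r_cvg|apply: cvg_sinh; exact: r_cvg].
Qed.

(** The level at which [u] is capped at [v]: high enough that the cap is inactive
at the initial time and that a hyperbolic radius decreases above it. *)
Lemma logarithmic_barrier g (r0 : vertices D -> R) v : exists b : R,
  ln (r0 v) <= b /\ (g = Hyperbolic -> forall r, (forall w, 0 < r w) ->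
    expR b <= r v -> 0 < curvature g Theta r v).
Proof.
have [M [_ K0]] := curvature_hyperbolic_gt0 v.
exists (Num.max (ln (r0 v)) (ln (`|M| + 1))); rewrite le_max lexx; split=> //.
move=> -> r r_gt0 br; apply: (K0 (r v)) => //.
apply: (@lt_le_trans _ _ (`|M| + 1)).
  by rewrite (le_lt_trans (ler_norm M))// ltrDl.
have M0 : 0 < `|M| + 1 by rewrite ltr_wpDl.
by apply: le_trans br; rewrite -[leLHS]lnK// ler_expR le_max lexx orbT.
Qed.

(** The cap is never active along a solution of the capped equation, so the
exponential of such a solution is a flow for the original curvature. *)
Theorem ricci_flow_exists g r0 : (forall v, 0 < r0 v) ->
  exists r : R -> vertices D -> R,
    (forall v, r 0 v = r0 v) /\ ricci_flow_solution g Theta r.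
Proof.
move=> r0_gt0.
have [b b_barrier] := choice (logarithmic_barrier g r0).
have [C speed_le] := choice (log_speed_bounded g b).
have [u [u0 uD]] := peano (fun v => ln (r0 v)) (fun w v => speed_le v w)
  (@log_speed_continuous g b).
have uncapped t v : 0 <= t -> cap g (b v) (u t v) = u t v.
  have [b_init b_curv] := b_barrier v.
  case: (g) b_curv uD => //= b_curv uD t0; apply/min_idPl.
  apply: (derivative_within_barrier (fun s s0 => uD s v s0)) t0 => [|s s0 bs].
    by rewrite u0.
  have K0 : 0 < curvature Hyperbolic Theta
      (fun w => expR (cap Hyperbolic (b w) (u s w))) v.
    apply: b_curv => // [w|]; first exact: expR_gt0.
    by rewrite ler_expR /= le_min bs lexx.
  rewrite /log_speed mulNr oppr_lt0 mulr_gt0// divr_gt0 ?expR_gt0//.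
  by rewrite /= sinh_gt0// expR_gt0.
exists (fun t v => expR (u t v)); split=> [v|t t0 v].
  by rewrite u0 lnK ?posrE.
split; first exact: expR_gt0.
have := derivative_within_expR (uD t v t0); rewrite /log_speed.
rewrite (_ : (fun w => _) = (fun w => expR (u t w))); last first.
  by apply/funext => w; rewrite uncapped.
congr has_derivative_within; rewrite uncapped//.
by rewrite mulrCA mulrA -[_ * (_ / _)]mulrA; field; rewrite gt_eqF// expR_gt0.
Qed.

End Curvature.

Theorem theorem1p4 (R : realType) (S : topologicalType)
    (hS : surface R S) (hnc : noncompact S)
    (D : cell_decomposition R S)
    (hinf : infinite_decomposition D)
    (hdeg : finite_degrees D)
    (hconn : connected_skeleton D)
    (Theta : edges D -> R)
    (hTheta : forall e, 0 < Theta e < pi)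
    (hC1 : condition_C1 Theta)
    (g : geometry)
    (r0 : vertices D -> R)
    (hr0 : forall v, 0 < r0 v) :
  exists r : R -> vertices D -> R,
    (forall v, r 0 v = r0 v) /\ ricci_flow_solution g Theta r.
Proof. exact: ricci_flow_exists. Qed.
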